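(* Let $C_n$ be the cycle graph with $n$ vertices, edge-colored with exactly $\ell\geq 2$ colors. Then \[\operatorname{wld}(C_n)=\begin{cases} n-2 & \text{if } \ell=2,\\ n-1 & \text{if } \ell>2.\end{cases}\]
   Context: An edge-colored graph $(G,\gamma)$ is a finite connected graph $G$ with a surjective function $\gamma:E(G)\to\mathcal{C}=\{c_1,\dots,c_\ell\}$ onto a finite set of colors (not necessarily a proper edge-coloring). For each color $c_i$ let $E_i(G)=\{e\in E(G):\gamma(e)=c_i\}$. For $W\subseteq E(G)$, let $G_i^W$ be the graph with vertex set $V(G)$ and edge set $W\cup E_i(G)$. The set $W$ is color-connecting if $G_i^W$ is connected for every color $c_i\in\mathcal{C}$. The wild number $\operatorname{wld}(G)$ is the minimum size of a color-connecting set. *)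

(* Defs.v *)
From mathcomp Require Import all_boot.

Set Implicit Arguments.
Unset Strict Implicit.
Unset Printing Implicit Defensive.

Record sgraph := SGraph {
  vertex :> finType;
  edges : {set {set vertex}};
  edges_card2 : {in edges, forall e : {set vertex}, #|e| = 2}
}.

Definition edge (G : sgraph) : finType := {e : {set G} | e \in edges G}.

Definition adj (G : sgraph) : rel G := fun x y => [set x; y] \in edges G.

Definition connected (G : sgraph) : bool :=
  [forall x : G, forall y : G, connect (@adj G) x y].

Lemma spanning_card2 (G : sgraph) (F : {set edge G}) :
  {in [set val e | e in F], forall e : {set G}, #|e| = 2}.
Proof. by move=> _ /imsetP[e _ ->]; apply: edges_card2 (valP e). Qed.

(* The graph with all the vertices of G and only the edges in F. *)
Definition spanning (G : sgraph) (F : {set edge G}) : sgraph :=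
  SGraph (@spanning_card2 G F).

(* The coloring need not be proper. *)
Record ecgraph := ECGraph {
  graph :> sgraph;
  graph_connected : connected graph;
  color : finType;
  coloring : edge graph -> color;
  coloring_surj : forall c : color, exists e : edge graph, coloring e = c
}.

Definition color_class (G : ecgraph) (c : color G) : {set edge G} :=
  [set e | coloring e == c].

Definition color_connecting (G : ecgraph) (W : {set edge G}) : bool :=
  [forall c : color G, connected (spanning (W :|: color_class c))].

Lemma color_connecting_setT (G : ecgraph) : color_connecting [set: edge G].
Proof.
apply/forallP => c; rewrite setTU.
apply/forallP => x; apply/forallP => y.
have /forallP/(_ x)/forallP/(_ y) := graph_connected G.
apply: connect_sub => u v uv; apply: connect1.
by apply/imsetP; exists (Sub [set u; v] uv : edge G); rewrite ?inE ?SubK.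
Qed.

Lemma color_connecting_size_ex (G : ecgraph) :
  exists m, [exists W : {set edge G}, color_connecting W && (#|W| == m)].
Proof.
exists #|[set: edge G]|; apply/existsP; exists [set: edge G].
by rewrite color_connecting_setT eqxx.
Qed.

Definition wld (G : ecgraph) : nat := ex_minn (color_connecting_size_ex G).

Definition cycle_edges (n : nat) : {set {set 'I_n}} :=
  [set [set i; ordS i] | i : 'I_n].

Lemma cycle_edges_card2 (n : nat) :
  2 < n -> {in cycle_edges n, forall e : {set 'I_n}, #|e| = 2}.
Proof.
move=> n_gt2 _ /imsetP[i _ ->]; rewrite cards2; suff -> : i != ordS i by [].
rewrite -val_eqE /=; have := ltn_ord i; rewrite leq_eqVlt => /predU1P[Ei|lti].
  by rewrite Ei modnn; apply: contraTneq n_gt2 => i0; rewrite -Ei i0.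
by rewrite modn_small // neq_ltn ltnSn.
Qed.

Definition cycle_graph (n : nat) (n_gt2 : 2 < n) : sgraph :=
  SGraph (cycle_edges_card2 n_gt2).

Lemma cycle_graph_connected (n : nat) (n_gt2 : 2 < n) :
  connected (cycle_graph n_gt2).
Proof.
have adjC : connect_sym (@adj (cycle_graph n_gt2)).
  by apply: sym_connect_sym => x y; rewrite /adj setUC.
have n_gt0 : 0 < n := ltn_trans (ltn0Sn 1) n_gt2.
have to0 k (ltkn : k < n) :
    connect (@adj (cycle_graph n_gt2)) (Ordinal n_gt0) (Ordinal ltkn).
  elim: k ltkn => [|k IHk] ltkn.
    by rewrite (bool_irrelevance ltkn n_gt0) connect0.
  apply: connect_trans (IHk (ltnW ltkn)) (connect1 _).
  apply/imsetP; exists (Ordinal (ltnW ltkn)) => //.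
  by congr [set _; _]; apply: val_inj; rewrite /= modn_small.
apply/forallP => -[x ltx]; apply/forallP => -[y lty].
by apply: (@connect_trans _ _ (Ordinal n_gt0)); rewrite ?to0 // adjC to0.
Qed.

(* Main.v *)
Require Import Defs.
From mathcomp Require Import all_boot.
From mathcomp Require Import zify.

Set Implicit Arguments.
Unset Strict Implicit.
Unset Printing Implicit Defensive.

(** A spanning subgraph of a cycle is connected iff it misses at most one edge.
    Hence [W] is color-connecting iff, for every color [c], at most one edge of
    the complement [M] of [W] has a color other than [c].  Two distinct colors
    already force [#|M| <= 2], two edges of distinct colors achieve this when
    there is no third color, and a third color forces [#|M| <= 1]. *)

Lemma adj_spanningP (G : sgraph) (F : {set edge G}) (x y : G) :
  reflect (exists2 e, e \in F & [set x; y] = val e) (@adj (spanning F) x y).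
Proof. exact: imsetP. Qed.

Section Cycle.

Variables (n : nat) (n_gt2 : 2 < n).
Local Notation Cn := (cycle_graph n_gt2).

Lemma val_iter_ordS k (x : 'I_n) : val (iter k (@ordS n) x) = (x + k) %% n.
Proof.
elim: k => [|k IHk] /=; first by rewrite addn0 modn_small.
by rewrite IHk -addn1 modnDml addn1 addnS.
Qed.

Lemma iter_ordS_onto (x y : 'I_n) : exists k, y = iter k (@ordS n) x.
Proof.
(* Since [x < n], the truncated subtraction is exact and [x] cancels, leaving [y + n]. *)
exists (y + (n - x)); apply: val_inj; rewrite val_iter_ordS.
have -> : x + (y + (n - x)) = y + n by have := ltn_ord x; lia.
by rewrite modnDr modn_small.
Qed.

Lemma val_ordS (k : 'I_n) : val (ordS k) = if k.+1 == n then 0 else k.+1.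
Proof.
rewrite /=; have := ltn_ord k; rewrite leq_eqVlt.
by case: eqVneq => [->|_ /= ltk]; rewrite ?modnn ?modn_small.
Qed.

Lemma cycle_edge_in (i : 'I_n) : [set i; ordS i] \in edges Cn.
Proof. exact: imset_f. Qed.

Definition cycle_edge (i : 'I_n) : edge Cn := Sub [set i; ordS i] (cycle_edge_in i).

Lemma cycle_edge_onto (e : edge Cn) : exists i, e = cycle_edge i.
Proof.
by have /imsetP[i _ ei] := valP e; exists i; apply: val_inj; rewrite ei SubK.
Qed.

(** Two distinct vertices giving the same edge would be successors of each other, so two steps would
    return to the start; [2 < n] excludes this. *)
Lemma cycle_edge_inj : injective cycle_edge.
Proof.
move=> i j /(congr1 val) eij.
have: i \in val (cycle_edge j) by rewrite -eij set21.
have: ordS i \in val (cycle_edge j) by rewrite -eij set22.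
rewrite !SubK !inE -!val_eqE !val_ordS => h1 h2; apply: val_inj => /=.
move: h1 h2; have := ltn_ord i; have := ltn_ord j; move: n_gt2 => /=.
by case: (i.+1 =P n); case: (j.+1 =P n); lia.
Qed.

Lemma card_cycle_edges : #|{: edge Cn}| = n.
Proof.
rewrite -[RHS]card_ord -(card_codom cycle_edge_inj).
by apply: eq_card => e; have [i ->] := cycle_edge_onto e; rewrite codom_f inE.
Qed.

Lemma connected_spanning_cycle_of (F : {set edge Cn}) (i : 'I_n) :
  (forall j, j != i -> cycle_edge j \in F) -> connected (spanning F).
Proof.
move=> Fj; have symF : connect_sym (@adj (spanning F)).
  by apply: sym_connect_sym => x y; rewrite /adj setUC.
have base y : connect (@adj (spanning F)) (ordS i) y.
  have [k ->] := iter_ordS_onto (ordS i) y.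
  elim: k => [|k IHk]; first exact: connect0.
  rewrite iterS; have [->|ne] := eqVneq (iter k (@ordS n) (ordS i)) i.
    exact: connect0.
  apply: connect_trans IHk (connect1 _); apply/adj_spanningP.
  by exists (cycle_edge (iter k (@ordS n) (ordS i))); rewrite ?SubK ?Fj.
apply/forallP => x; apply/forallP => y.
by apply: (@connect_trans _ _ (ordS i)); rewrite // symF.
Qed.

(** Only the two missing edges leave the arc [i+1, ..., j], which contains [j] but not [i]. Taking
    [i < j] keeps this arc from wrapping around. *)
Lemma disconnected_spanning_cycle (F : {set edge Cn}) (i j : 'I_n) :
  i < j -> cycle_edge i \notin F -> cycle_edge j \notin F ->
  ~~ connected (spanning F).
Proof.
move=> ltij iF jF; pose S := [pred k : 'I_n | i < k <= j].
have clS : closed (@adj (spanning F)) S.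
  move=> x y /adj_spanningP[e]; have [k ->] := cycle_edge_onto e.
  move=> kF exy; have ki : k != i by apply: contraNneq iF => <-.
  have kj : k != j by apply: contraNneq jF => <-.
  (* At the wrap-around [k = n-1] the successor [0] is outside the arc, and so is [k], since
     [k <= j] would force [k = j]. *)
  have Sk : (k \in S) = (ordS k \in S).
    rewrite !inE val_ordS; move: ki kj; rewrite -!val_eqE /=.
    by have := ltn_ord j; have := ltn_ord k; case: (k.+1 =P n); lia.
  have: x \in val (cycle_edge k) by rewrite -exy set21.
  have: y \in val (cycle_edge k) by rewrite -exy set22.
  by rewrite SubK !in_set2 => /orP[]/eqP-> /orP[]/eqP->.
apply/negP => /forallP/(_ i)/forallP/(_ j)/(closed_connect clS).
by rewrite !inE ltnn ltij leqnn.
Qed.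

Lemma connected_spanning_cycle (F : {set edge Cn}) :
  connected (spanning F) = (#|~: F| <= 1).
Proof.
apply/idP/card_le1_eqP => [conF e f | F1].
  have [i ->] := cycle_edge_onto e; have [j ->] := cycle_edge_onto f.
  rewrite !inE => iF jF; have [ltij|ltji|/val_inj-> //] := ltngtP i j.
    by have := disconnected_spanning_cycle ltij iF jF; rewrite conF.
  by have := disconnected_spanning_cycle ltji jF iF; rewrite conF.
have [F0|[e eF]] := set_0Vmem (~: F).
  (* No edge is missing, so any exceptional index will do; this one is [0]. *)
  apply: (@connected_spanning_cycle_of F (Ordinal (ltnW (ltnW n_gt2)))) => j _.
  by apply: contraT; rewrite -in_setC F0 inE.
have [i ei] := cycle_edge_onto e; apply: (@connected_spanning_cycle_of F i) => j.
apply: contraNT; rewrite -in_setC => jF; apply/eqP/cycle_edge_inj.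
by rewrite -ei; apply: F1.
Qed.

Section Coloring.

Variables (C : finType) (gamma : edge Cn -> C).
Hypothesis gamma_surj : forall c, exists e, gamma e = c.
Local Notation G := (ECGraph (cycle_graph_connected n_gt2) gamma_surj).

(** The edges absent from both [~: M] and the class of [c] are those of [M] not colored [c]. *)
Lemma color_connecting_cycleC (M : {set edge Cn}) :
  color_connecting (~: M : {set edge G}) =
  [forall c, #|[set e in M | gamma e != c]| <= 1].
Proof.
apply: eq_forallb => c; rewrite connected_spanning_cycle.
by congr (_ <= 1); apply: eq_card => e; rewrite !inE negb_or negbK.
Qed.

(** No edge has both colors [c] and [d], so [M] is covered by its non-[c] and its non-[d] edges, at
    most one of each. *)
Lemma color_connecting_cycle_le2 (M : {set edge Cn}) :
  1 < #|C| -> color_connecting (~: M : {set edge G}) -> #|M| <= 2.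
Proof.
move=> /card_gt1P[c [d [_ _ cd]]]; rewrite color_connecting_cycleC => /forallP Mc.
apply: leq_trans (leq_add (Mc c) (Mc d)); apply: leq_trans (leq_card_setU _ _).
apply/subset_leq_card/subsetP => e eM; rewrite !inE eM /= -negb_and.
by apply: contraNN cd => /andP[/eqP-> /eqP->].
Qed.

(** For any two edges of [M] some color differs from both of theirs, and the bound for that color
    makes them equal. *)
Lemma color_connecting_cycle_le1 (M : {set edge Cn}) :
  2 < #|C| -> color_connecting (~: M : {set edge G}) -> #|M| <= 1.
Proof.
move=> C_gt2; rewrite color_connecting_cycleC => /forallP Mc.
apply/card_le1_eqP => e f eM fM.
have [c] : exists c, c \notin [set gamma e; gamma f].
  apply/existsP; rewrite -negb_forall; apply: contraTN C_gt2 => /forallP cef.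
  rewrite -leqNgt -cardsT; apply: (@leq_trans #|[set gamma e; gamma f]|).
    by apply/subset_leq_card/subsetP.
  by rewrite cards2; case: eqP.
rewrite !inE negb_or ![c == _]eq_sym => /andP[ec fc].
by apply: (card_le1_eqP (Mc c)); rewrite inE ?eM ?fM.
Qed.

Lemma color_connecting_cycle1 (e : edge Cn) :
  color_connecting (~: [set e] : {set edge G}).
Proof.
rewrite color_connecting_cycleC; apply/forallP => c.
rewrite -(cards1 e); apply/subset_leq_card/subsetP => f; rewrite !inE.
by case/andP.
Qed.

(** With two colors in all, each color is that of [e] or of [f], which leaves only the other edge to
    be counted against it. *)
Lemma color_connecting_cycle2 (e f : edge Cn) :
  #|C| = 2 -> gamma e != gamma f ->
  color_connecting (~: [set e; f] : {set edge G}).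
Proof.
move=> C2 ef; rewrite color_connecting_cycleC; apply/forallP => c.
have: c \in [set gamma e; gamma f].
  suff -> : [set gamma e; gamma f] = setT by rewrite inE.
  by apply/eqP; rewrite eqEcard subsetT cardsT C2 cards2 ef.
rewrite !inE => /orP[]/eqP->; apply/card_le1_eqP => a b; rewrite !inE;
  by move=> /andP[/orP[]/eqP-> +] /andP[/orP[]/eqP-> +]; rewrite ?eqxx.
Qed.

(** Complementation in the [n] edges turns the minimum over [W] into a maximum over removed sets,
    attained at [M]. *)
Lemma wld_cycle_eq (k : nat) (M : {set edge Cn}) :
    color_connecting (~: M : {set edge G}) -> #|M| = k ->
    (forall N : {set edge Cn},
       color_connecting (~: N : {set edge G}) -> #|N| <= k) ->
  wld G = n - k.
Proof.
move=> ccM Mk max_k; rewrite /wld; case: ex_minnP => m.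
case/existsP => W /andP[ccW /eqP<-] min_m; apply/eqP; rewrite eqn_leq.
apply/andP; split.
  apply: min_m; apply/existsP; exists (~: M); rewrite ccM /=.
  by rewrite cardsCs setCK card_cycle_edges Mk.
have := cardsC W; rewrite card_cycle_edges leq_subLR => {1}<-.
by rewrite addnC leq_add2r; apply: max_k; rewrite setCK.
Qed.

End Coloring.

End Cycle.

Theorem proposition3p3 (n l : nat) (n_gt2 : 2 < n) (C : finType)
    (gamma : edge (cycle_graph n_gt2) -> C)
    (gamma_surj : forall c : C, exists e : edge (cycle_graph n_gt2), gamma e = c)
    (card_C : #|C| = l) (l_ge2 : 2 <= l) :
  wld (ECGraph (cycle_graph_connected n_gt2) gamma_surj) =
  if l == 2 then n - 2 else n - 1.
Proof.
have C_gt1 : 1 < #|C| by rewrite card_C.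
have /card_gt1P[c [d [_ _ cd]]] := C_gt1.
have [e ec] := gamma_surj c; have [f fd] := gamma_surj d.
have gef : gamma e != gamma f by rewrite ec fd.
case: eqVneq => [l2|l_ne2].
  apply: (@wld_cycle_eq _ _ _ _ _ 2 [set e; f]).
  - by apply: color_connecting_cycle2; rewrite // card_C.
  - by rewrite cards2; have -> : e != f by apply: contraNneq gef => ->.
  - by move=> N; apply: color_connecting_cycle_le2.
apply: (@wld_cycle_eq _ _ _ _ _ 1 [set e]).
- exact: color_connecting_cycle1.
- exact: cards1.
- by move=> N; apply: color_connecting_cycle_le1; rewrite card_C ltn_neqAle eq_sym l_ne2.
Qed.
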